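(* Let $A=\Bbbk Q/I$ be a monomial algebra. If $A$ is a UMP algebra, then every weakly connected component of the ramifications graph $G_{Q,I}$ is unilaterally connected.
   Context: Setting: $\Bbbk$ is an algebraically closed field, $Q$ is a finite connected quiver with vertex set $Q_0$, arrow set $Q_1$ and source and target maps $s,t$; $I$ is an admissible ideal of $\Bbbk Q$, and $A=\Bbbk Q/I$ (finite-dimensional). Paths are composed from left to right: $\alpha\beta$ is a path when $t(\alpha)=s(\beta)$ (products of non-composable paths are $0$). $A$ is monomial if $I$ is generated by paths. A nontrivial path $w$ is written $w=w^0w^1\cdots w^{l_w}$ with $w^i\in Q_1$, so its length is $l_w+1$; $s(w)=s(w^0)$, $t(w)=t(w^{l_w})$. UMP algebras: for a path $\mathfrak m$ of $Q$, $\mathfrak m+I$ is a maximal path of $A$ if $\mathfrak m\notin I$ and $\alpha\mathfrak m\in I$ and $\mathfrak m\alpha\in I$ for every arrow $\alpha\in Q_1$. Two paths of $Q$ are disjoint if they have no common nontrivial subpath. Two maximal paths $\mathfrak m+I$, $\mathfrak m'+I$ are disjoint if any path $w$ of $Q$ representing $\mathfrak m+I$ and any path $w'$ of $Q$ representing $\mathfrak m'+I$ are disjoint. $A$ is a UMP algebra if any two different maximal paths of $A$ are disjoint. Ramifications graph: for each $a\in Q_1$ define a path $\omega_a$ as follows. (i) If $Q$ is a cyclic quiver (a single oriented cycle), fix a path $\alpha_0\cdots\alpha_k$ without repeated arrows, where $\alpha_0,\dots,\alpha_k$ are all the arrows of $Q$, and put $\omega_a:=\alpha_0\cdots\alpha_k$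 for every $a\in Q_1$. (ii) If $Q$ is not a cyclic quiver, let $\Phi_a$ be the set of paths $\omega$ such that $a$ is a subpath of $\omega$ and, if $l_\omega>0$, then for every vertex $i\in\{t(\omega^j):0\le j<l_\omega\}$ there is exactly one arrow of $Q$ starting at $i$ and exactly one arrow of $Q$ ending at $i$; then $\omega_a$ is the path of maximal length in $\Phi_a$. The ramifications graph $G_{Q,I}=(V,E)$ is the oriented graph with $V=\{\omega_a: a\in Q_1\}$ and with a directed edge from $\omega_a$ to $\omega_b$ if and only if $\omega_a\neq\omega_b$, $t(\omega_a)=s(\omega_b)$, and the product of the last arrow of $\omega_a$ with the first arrow of $\omega_b$ is not in $I$. A weakly connected component of $G_{Q,I}$ is a subgraph whose underlying undirected graph is a connected component of the underlying undirected graph of $G_{Q,I}$. An oriented graph is unilaterally connected if for any pair of vertices $i,j$ it contains an oriented path from $i$ to $j$ or from $j$ to $i$. *)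

(* Defs.v *)
From Stdlib Require Import Relation_Operators.
From HB Require Import structures.
From mathcomp Require Import all_boot all_algebra.
From mathcomp Require Import finmap monalg.

Set Implicit Arguments.
Unset Strict Implicit.
Unset Printing Implicit Defensive.

Import GRing.Theory.
Local Open Scope ring_scope.

Record quiver := Quiver {
  vertex : finType;
  arrow : finType;
  src : arrow -> vertex;
  tgt : arrow -> vertex
}.
Arguments src {q} _.
Arguments tgt {q} _.

Definition connected_quiver (Q : quiver) : Prop :=
  forall i j : vertex Q,
    connect (fun u v => [exists a : arrow Q,
      ((src a == u) && (tgt a == v)) || ((src a == v) && (tgt a == u))]) i j.

(* Q is a single oriented cycle: c lists its arrows in cyclic order, and their
   sources are all the vertices of Q, without repetition. *)
Definition cyclic_quiver (Q : quiver) : Prop :=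
  exists c : seq (arrow Q),
    [/\ c != [::], cycle (fun a b => tgt a == src b) c, uniq (map src c),
        forall a, a \in c & forall i, i \in map src c].

(* A path is a starting vertex together with its sequence of arrows; the
   trivial path at i is (i, [::]). *)
Section Paths.
Variable Q : quiver.

Fixpoint chain (i : vertex Q) (s : seq (arrow Q)) : bool :=
  if s is a :: s' then (src a == i) && chain (tgt a) s' else true.

Record qpath := QPath {
  qpath_val : vertex Q * seq (arrow Q);
  qpathP : chain qpath_val.1 qpath_val.2
}.
HB.instance Definition _ := [isSub for qpath_val].
HB.instance Definition _ := [Choice of qpath by <:].

Definition psrc (p : qpath) : vertex Q := (qpath_val p).1.
Definition parrows (p : qpath) : seq (arrow Q) := (qpath_val p).2.
Definition ptgt (p : qpath) : vertex Q := last (psrc p) (map tgt (parrows p)).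
Definition plen (p : qpath) : nat := size (parrows p).
Definition nontrivial (p : qpath) : bool := (0 < plen p)%N.

Definition vpath (i : vertex Q) : qpath := @QPath (i, [::]) isT.

Lemma apath_subproof (a : arrow Q) : chain (src a) [:: a].
Proof. by rewrite /= eqxx. Qed.
Definition apath (a : arrow Q) : qpath := @QPath (src a, [:: a]) (apath_subproof a).

Lemma chain_cat i s1 s2 :
  chain i (s1 ++ s2) = chain i s1 && chain (last i (map tgt s1)) s2.
Proof. by elim: s1 i => //= a s1 IH i; rewrite IH andbA. Qed.

Lemma pcat_subproof (p q : qpath) :
  ptgt p = psrc q -> chain (psrc p) (parrows p ++ parrows q).
Proof.
by move=> pq; rewrite chain_cat (qpathP p) -/(ptgt p) pq; apply: (qpathP q).
Qed.

(* Left-to-right composition, None when the paths are not composable. *)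
Definition pcat (p q : qpath) : option qpath :=
  match ptgt p =P psrc q with
  | ReflectT pq =>
      Some (@QPath (psrc p, parrows p ++ parrows q) (pcat_subproof pq))
  | ReflectF _ => None
  end.

Definition subpath (u w : qpath) : Prop :=
  exists x y v, pcat x u = Some v /\ pcat v y = Some w.

Definition disjoint_paths (w w' : qpath) : Prop :=
  forall u, nontrivial u -> subpath u w -> ~ subpath u w'.

Lemma qpath_eq (p q : qpath) :
  psrc p = psrc q -> parrows p = parrows q -> p = q.
Proof.
case: p q => [[i s] P] [[j t] R]; rewrite /psrc /parrows /= => eij est.
by apply: val_inj; rewrite /= eij est.
Qed.

Variant pcat_spec (p q : qpath) : option qpath -> Prop :=
| PcatSome r of ptgt p = psrc q & psrc r = psrc p
    & parrows r = parrows p ++ parrows q : pcat_spec p q (Some r)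
| PcatNone of ptgt p <> psrc q : pcat_spec p q None.

Lemma pcatP p q : pcat_spec p q (pcat p q).
Proof.
by rewrite /pcat; case: eqP => [pq|npq]; constructor.
Qed.

Lemma ptgt_cat p q r : ptgt p = psrc q -> psrc r = psrc p ->
  parrows r = parrows p ++ parrows q -> ptgt r = ptgt q.
Proof. by move=> pq r1 r2; rewrite /ptgt r1 r2 map_cat last_cat -pq. Qed.

Lemma pcatA p q r : obind (pcat p) (pcat q r) = obind (pcat^~ r) (pcat p q).
Proof.
case: (pcatP q r) => [v qr v1 v2|nqr]; case: (pcatP p q) => [u pq u1 u2|npq] //=.
- case: (pcatP p v) => [w _ w1 w2|]; last by rewrite v1.
  case: (pcatP u r) => [x _ x1 x2|]; last by rewrite (ptgt_cat pq u1 u2).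
  congr Some; apply: qpath_eq; first by rewrite w1 x1 u1.
  by rewrite w2 x2 u2 v2 catA.
- by case: (pcatP p v) => [w + _ _|//]; rewrite v1.
- by case: (pcatP u r) => [w + _ _|//]; rewrite (ptgt_cat pq u1 u2).
Qed.

Lemma pcat_vl i p : pcat (vpath i) p = if i == psrc p then Some p else None.
Proof.
case: (pcatP (vpath i) p) => [r ip r1 r2|nip]; last first.
  by case: eqP => // ip; case: nip.
rewrite -ip eqxx; congr Some; apply: qpath_eq; last exact: r2.
by rewrite r1 -ip.
Qed.

Lemma pcat_vr i p : pcat p (vpath i) = if i == ptgt p then Some p else None.
Proof.
case: (pcatP p (vpath i)) => [r ip r1 r2|nip]; last first.
  by case: eqP => // ip; case: nip.
by rewrite ip eqxx; congr Some; apply: qpath_eq => //; rewrite r2 cats0.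
Qed.

End Paths.

(* The path algebra KQ: the free K-module on the paths of Q, with the bilinear
   extension of composition of paths. *)
Definition pathalg (K : fieldType) (Q : quiver) : Type := {malg K[qpath Q]}.
HB.instance Definition _ (K : fieldType) (Q : quiver) :=
  GRing.Lmodule.on (pathalg K Q).

(* pelt and pa_mul are locked to keep unification from unfolding them. *)
HB.lock Definition pelt (K : fieldType) (Q : quiver) (p : qpath Q) : pathalg K Q :=
  << p >>.
Arguments pelt {K Q} p.

Definition pelt_mul (K : fieldType) (Q : quiver) (p q : qpath Q) : pathalg K Q :=
  if pcat p q is Some r then pelt r else 0.

Definition pa_one (K : fieldType) (Q : quiver) : pathalg K Q :=
  \sum_(i : vertex Q) pelt (vpath i).

HB.lock Definition pa_mul (K : fieldType) (Q : quiver) (x y : pathalg K Q) :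
    pathalg K Q :=
  \sum_(p <- msupp x) \sum_(q <- msupp y) (x@_p * y@_q) *: pelt_mul K p q.

Section PathAlgebra.
Variables (K : fieldType) (Q : quiver).
Implicit Types (p q : qpath Q) (x y z : pathalg K Q).
Local Notation pa_mul := (@pa_mul K Q).
Local Notation pa_one := (pa_one K Q).
Local Notation pelt_mul := (@pelt_mul K Q).
Local Notation pelt := (@pelt K Q).


Lemma pa_mulw (d1 d2 : {fset qpath Q}) x y :
  (msupp x `<=` d1)%fset -> (msupp y `<=` d2)%fset ->
  pa_mul x y = \sum_(p <- d1) \sum_(q <- d2) (x@_p * y@_q) *: pelt_mul p q.
Proof.
move=> le1 le2; rewrite pa_mul.unlock (big_fset_incl _ le1) /=.
  apply/eq_bigr=> p _; apply/big_fset_incl => // q _ /mcoeff_outdom ->.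
  by rewrite mulr0 scale0r.
move=> p _ /mcoeff_outdom xp.
by rewrite big1 // => q _; rewrite xp mul0r scale0r.
Qed.

Lemma pa_mulDl : left_distributive pa_mul +%R.
Proof.
move=> x y z.
pose d := (msupp x `|` msupp y)%fset.
rewrite (@pa_mulw d (msupp z)) ?msuppD_le // (@pa_mulw d (msupp z) x) ?fsubsetUl //.
rewrite (@pa_mulw d (msupp z) y) ?fsubsetUr // -big_split; apply/eq_bigr => p _ /=.
by rewrite -big_split; apply/eq_bigr => q _ /=; rewrite mcoeffD mulrDl scalerDl.
Qed.

Lemma pa_mulDr : right_distributive pa_mul +%R.
Proof.
move=> x y z.
pose d := (msupp y `|` msupp z)%fset.
rewrite (@pa_mulw (msupp x) d) ?msuppD_le // (@pa_mulw (msupp x) d x y) ?fsubsetUl //.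
rewrite (@pa_mulw (msupp x) d x z) ?fsubsetUr // -big_split; apply/eq_bigr => p _ /=.
by rewrite -big_split; apply/eq_bigr => q _ /=; rewrite mcoeffD mulrDr scalerDl.
Qed.

Lemma pa_mul0l y : pa_mul 0 y = 0.
Proof. by rewrite pa_mul.unlock msupp0 big_seq_fset0. Qed.

Lemma pa_mul0r x : pa_mul x 0 = 0.
Proof. by rewrite pa_mul.unlock msupp0 big1 // => p _; rewrite big_seq_fset0. Qed.

Lemma pa_mulZl (c : K) x y : pa_mul (c *: x) y = c *: pa_mul x y.
Proof.
rewrite (@pa_mulw (msupp x) (msupp y)) ?msuppZ_le // pa_mul.unlock scaler_sumr.
apply/eq_bigr => p _; rewrite scaler_sumr; apply/eq_bigr => q _.
by rewrite mcoeffZ scalerA mulrA.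
Qed.

Lemma pa_mulZr (c : K) x y : pa_mul x (c *: y) = c *: pa_mul x y.
Proof.
rewrite (@pa_mulw (msupp x) (msupp y)) ?msuppZ_le // pa_mul.unlock scaler_sumr.
apply/eq_bigr => p _; rewrite scaler_sumr; apply/eq_bigr => q _.
by rewrite mcoeffZ scalerA mulrCA.
Qed.

Lemma pa_mulUU p q : pa_mul (pelt p) (pelt q) = pelt_mul p q.
Proof.
rewrite (@pa_mulw [fset p]%fset [fset q]%fset) ?pelt.unlock ?msuppU_le //.
by rewrite !big_seq_fset1 !mcoeffUU mulr1 scale1r.
Qed.

Lemma pa_expand x : x = \sum_(p <- msupp x) x@_p *: pelt p.
Proof.
rewrite {1}[x]monalgE; apply/eq_bigr => p _; apply/malgP => q.
by rewrite [RHS]mcoeffZ [LHS]mcoeffU pelt.unlock mcoeffU mulrnAr mulr1.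
Qed.

Lemma pa_mul_suml (T : Type) (r : seq T) (F : T -> pathalg K Q) y :
  pa_mul (\sum_(t <- r) F t) y = \sum_(t <- r) pa_mul (F t) y.
Proof.
exact: (big_morph (pa_mul^~ y) (fun _ _ => pa_mulDl _ _ _) (pa_mul0l y)).
Qed.

Lemma pa_mul_sumr (T : Type) (r : seq T) (F : T -> pathalg K Q) x :
  pa_mul x (\sum_(t <- r) F t) = \sum_(t <- r) pa_mul x (F t).
Proof.
exact: (big_morph (pa_mul x) (fun _ _ => pa_mulDr _ _ _) (pa_mul0r x)).
Qed.

Lemma pa_ind (P : pathalg K Q -> Prop) :
  P 0 -> (forall x y, P x -> P y -> P (x + y)) ->
  (forall c p, P (c *: pelt p)) -> forall x, P x.
Proof. by move=> P0 PD PU x; rewrite [x]pa_expand; apply: big_ind. Qed.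

Lemma pa_mulA : associative pa_mul.
Proof.
move=> x y z; elim/pa_ind: x => [|x x' IH IH'|c p].
- by rewrite !pa_mul0l.
- by rewrite !pa_mulDl IH IH'.
rewrite !pa_mulZl; congr (_ *: _).
elim/pa_ind: y => [|y y' IH IH'|d q].
- by rewrite pa_mul0l !pa_mul0r pa_mul0l.
- by rewrite pa_mulDl !pa_mulDr pa_mulDl IH IH'.
have midZ (V : lmodType K) (m : V -> V -> V) u v w :
    (forall a b, m (d *: a) b = d *: m a b) ->
    (forall a b, m a (d *: b) = d *: m a b) ->
    m u (m v w) = m (m u v) w -> m u (m (d *: v) w) = m (m u (d *: v)) w.
  by move=> mZl mZr E; rewrite mZl !mZr mZl E.
apply: midZ => [a b|a b|]; [exact: pa_mulZl | exact: pa_mulZr |].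
elim/pa_ind: z => [|z z' IH IH'|e r].
- by rewrite !pa_mul0r.
- by rewrite !pa_mulDr IH IH'.
rewrite !pa_mulZr; congr (_ *: _).
rewrite !pa_mulUU.
move: (pcatA p q r); rewrite /pelt_mul.
case: (pcat q r) (pcat p q) => [v|] [u|] /= E;
  rewrite ?pa_mulUU ?pa_mul0l ?pa_mul0r // /pelt_mul.
- by rewrite E.
- by rewrite E.
- by rewrite -E.
Qed.

Lemma pa_mul1l : left_id pa_one pa_mul.
Proof.
elim/pa_ind => [|x y IH IH'|c p]; first exact: pa_mul0r.
  by rewrite pa_mulDr IH IH'.
rewrite pa_mulZr /pa_one pa_mul_suml; congr (_ *: _).
rewrite (bigD1 (psrc p)) //= pa_mulUU /pelt_mul pcat_vl eqxx.
by rewrite big1 ?addr0 // => i /negPf ne; rewrite pa_mulUU /pelt_mul pcat_vl ne.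
Qed.

Lemma pa_mul1r : right_id pa_one pa_mul.
Proof.
elim/pa_ind => [|x y IH IH'|c p]; first exact: pa_mul0l.
  by rewrite pa_mulDl IH IH'.
rewrite pa_mulZl /pa_one pa_mul_sumr; congr (_ *: _).
rewrite (bigD1 (ptgt p)) //= pa_mulUU /pelt_mul pcat_vr eqxx.
by rewrite big1 ?addr0 // => i /negPf ne; rewrite pa_mulUU /pelt_mul pcat_vr ne.
Qed.

HB.instance Definition _ := GRing.Zmodule_isPzRing.Build (pathalg K Q)
  pa_mulA pa_mul1l pa_mul1r pa_mulDl pa_mulDr.

Lemma pa_scalerAl (c : K) x y : c *: (x * y) = (c *: x) * y.
Proof. exact: esym (pa_mulZl c x y). Qed.

Lemma pa_scalerAr (c : K) x y : c *: (x * y) = x * (c *: y).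
Proof. exact: esym (pa_mulZr c x y). Qed.

Lemma peltM p q : pelt p * pelt q = if pcat p q is Some r then pelt r else 0.
Proof. exact: pa_mulUU. Qed.

End PathAlgebra.

(* Two-sided ideals, as Prop-valued subsets of a possibly trivial ring. *)
Section Ideals.
Variable R : pzRingType.
Implicit Types I J S : R -> Prop.

Definition ideal I : Prop :=
  [/\ I 0, forall x y, I x -> I y -> I (x + y),
      forall a x, I x -> I (a * x) & forall a x, I x -> I (x * a)].

Definition ideal_gen S : R -> Prop :=
  fun x => forall J, ideal J -> (forall y, S y -> J y) -> J x.

Definition ideal_mul I J : R -> Prop :=
  ideal_gen (fun z => exists x y, [/\ I x, J y & z = x * y]).

Definition ideal_exp I (n : nat) : R -> Prop :=
  iter n (ideal_mul I) (fun=> True).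

End Ideals.

Section BoundQuivers.
Variables (K : fieldType) (Q : quiver) (I : pathalg K Q -> Prop).

Definition arrow_ideal : pathalg K Q -> Prop :=
  ideal_gen (fun x => exists a : arrow Q, x = pelt (apath a)).

Definition admissible : Prop :=
  ideal I /\
  exists m : nat, [/\ (2 <= m)%N,
    forall x, ideal_exp arrow_ideal m x -> I x &
    forall x, I x -> ideal_exp arrow_ideal 2 x].

Definition monomial : Prop :=
  exists S : qpath Q -> Prop,
    forall x, I x <-> ideal_gen (fun y => exists2 p, S p & y = pelt p) x.

(* Elements of A = KQ/I are handled through representatives: x + I = y + I is
   expressed as I (x - y). *)
Definition same_class (w w' : qpath Q) : Prop := I (pelt w - pelt w').

Definition maximal_path (m : qpath Q) : Prop :=
  ~ I (pelt m) /\
  forall a : arrow Q,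
    I (pelt (apath a) * pelt m) /\ I (pelt m * pelt (apath a)).

Definition disjoint_classes (m m' : qpath Q) : Prop :=
  forall w w', same_class w m -> same_class w' m' -> disjoint_paths w w'.

Definition UMP : Prop :=
  forall m m', maximal_path m -> maximal_path m' -> ~ same_class m m' ->
    disjoint_classes m m'.

End BoundQuivers.

Record digraph (T : Type) := Digraph {
  vtx : T -> Prop;
  arc : T -> T -> Prop;
  arc_vtx : forall x y, arc x y -> vtx x /\ vtx y
}.

Section Digraphs.
Variable T : Type.
Implicit Types G H : digraph T.

Definition undirected_arc G : T -> T -> Prop := fun x y => arc G x y \/ arc G y x.

(* A component carries all the arcs of G between its vertices. *)
Definition weak_component G H : Prop :=
  (exists2 x, vtx G x &
     forall y, vtx H y <-> clos_refl_trans T (undirected_arc G) x y) /\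
  (forall y z, arc H y z <-> [/\ vtx H y, vtx H z & arc G y z]).

Definition unilaterally_connected G : Prop :=
  forall i j, vtx G i -> vtx G j ->
    clos_refl_trans T (arc G) i j \/ clos_refl_trans T (arc G) j i.

End Digraphs.

Section Ramifications.
Variables (K : fieldType) (Q : quiver) (I : pathalg K Q -> Prop).

(* The set Phi_a; the default value a of nth is never used. *)
Definition Phi (a : arrow Q) (w : qpath Q) : Prop :=
  subpath (apath a) w /\
  forall j : nat, (j.+1 < plen w)%N ->
    let i := tgt (nth a (parrows w) j) in
    #|[pred b : arrow Q | src b == i]| = 1%N /\
    #|[pred b : arrow Q | tgt b == i]| = 1%N.

(* omega is a possible choice of the family of the paths omega_a: for a cyclic
   quiver, the path listing all arrows may be fixed arbitrarily. *)
Definition ramification_family (omega : arrow Q -> qpath Q) : Prop :=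
  (cyclic_quiver Q ->
     exists w : qpath Q, [/\ uniq (parrows w), forall a, a \in parrows w &
                             forall a, omega a = w]) /\
  (~ cyclic_quiver Q ->
     forall a, Phi a (omega a) /\
               forall w, Phi a w -> (plen w <= plen (omega a))%N).

Variable omega : arrow Q -> qpath Q.

Definition ramif_vtx (w : qpath Q) : Prop := exists a, w = omega a.

Definition ramif_arc (w w' : qpath Q) : Prop :=
  [/\ ramif_vtx w, ramif_vtx w', w <> w', ptgt w = psrc w' &
      exists s s' b c,
        [/\ parrows w = rcons s b, parrows w' = c :: s' &
            ~ I (pelt (apath b) * pelt (apath c))]].

Lemma ramif_arc_vtx w w' : ramif_arc w w' -> ramif_vtx w /\ ramif_vtx w'.
Proof. by case. Qed.

Definition ramif_graph : digraph (qpath Q) := Digraph ramif_arc_vtx.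

End Ramifications.

(* Main.v *)
(* Say that a -> b for arrows a, b with ab not in I. As A is finite-dimensional,
   monomial and UMP, every arrow lies on exactly one maximal path, so "a and b
   lie on the same maximal path" is an equivalence relation; it contains ->, and
   two equivalent arrows are joined by a ->-walk in one of the two directions.
   When a -> b, the paths omega_a and omega_b are equal or joined by an arc, so
   ->-walks project to the ramifications graph. If two consecutive arrows c, d of
   some omega satisfy cd in I, then, d being the only arrow after c and c the
   only one before d, the maximal path of c ends at c and that of d starts at d.
   Hence for each omega, either its first and last arrows lie on the same maximal
   path, or omega reaches everything on the maximal path of its last arrow (and
   is reached from everything on that of its first). An induction on the length
   of an oriented path then shows that comparability for reachability survives
   adding an arc in either direction, so it holds along any undirected walk. *)
Require Import Defs.
From mathcomp Require Import all_boot all_algebra.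
From Stdlib Require Import Classical Relation_Operators Operators_Properties.
From mathcomp Require Import finmap monalg.

Set Implicit Arguments.
Unset Strict Implicit.
Unset Printing Implicit Defensive.

Import GRing.Theory.
Local Open Scope ring_scope.

(** * Splitting paths and recovering them from their arrows *)

Section PathFacts.
Variable Q : quiver.
Implicit Types (p q r w : qpath Q) (a b : arrow Q) (s : seq (arrow Q)).

Lemma pcat_split p s1 s2 : parrows p = s1 ++ s2 ->
  exists p1 p2, [/\ parrows p1 = s1, parrows p2 = s2 & pcat p1 p2 = Some p].
Proof.
move=> ps; have := qpathP p; rewrite -/(psrc p) -/(parrows p) ps chain_cat.
case/andP=> c1 c2.
exists (@QPath Q (psrc p, s1) c1), (@QPath Q (_, s2) c2); split=> //.
case: pcatP => [r _ r1 r2|[]//].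
by congr Some; apply: qpath_eq; rewrite ?r1 // r2 ps.
Qed.

Lemma parrows_pcat p q r : pcat p q = Some r -> parrows r = parrows p ++ parrows q.
Proof. by case: pcatP => // r' _ _ rE [<-]. Qed.

Lemma qpath_arrow p a : parrows p = [:: a] -> p = apath a.
Proof.
move=> pa; apply: qpath_eq => //.
have := qpathP p; rewrite -/(psrc p) -/(parrows p) pa /= andbT.
by move/eqP.
Qed.

Lemma qpath_eq_parrows p q : parrows p != [::] -> parrows p = parrows q -> p = q.
Proof.
case pE: (parrows p) => [//|a s] _ qE; apply: qpath_eq; last by rewrite pE.
have := qpathP p; have := qpathP q.
rewrite -!/(psrc _) -!/(parrows _) pE -qE /=.
by case/andP=> /eqP<- _ /andP[/eqP<-].
Qed.

Lemma subpath_apath a w : subpath (apath a) w <-> a \in parrows w.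
Proof.
split.
  case=> x [y [v [/parrows_pcat vE /parrows_pcat ->]]].
  by rewrite vE !mem_cat inE eqxx orbT.
move=> aw; case/splitPr wE: _ / aw => [s1 s2].
have [v [y [vE _ vy]]] : exists p1 p2, [/\ parrows p1 = rcons s1 a,
    parrows p2 = s2 & pcat p1 p2 = Some w].
  by apply: pcat_split; rewrite cat_rcons.
have [x [z [_ zE xz]]] : exists p1 p2, [/\ parrows p1 = s1,
    parrows p2 = [:: a] & pcat p1 p2 = Some v].
  by apply: pcat_split; rewrite vE cats1.
by exists x, y, v; rewrite -(qpath_arrow zE).
Qed.

End PathFacts.

(** * Supports in the path algebra and powers of the arrow ideal *)

Section Algebra.
Variables (K : fieldType) (Q : quiver).
Implicit Types (p q r w : qpath Q) (a b : arrow Q) (x y : pathalg K Q).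

Lemma pelt_pcat p q r : pcat p q = Some r -> pelt p * pelt q = pelt r :> pathalg K Q.
Proof. by rewrite peltM => ->. Qed.

Lemma msupp_pelt p : msupp (pelt p : pathalg K Q) = [fset p]%fset.
Proof. by rewrite pelt.unlock msuppU oner_eq0. Qed.

Lemma msupp_mul x y p : p \in msupp (x * y) ->
  exists q r, [/\ q \in msupp x, r \in msupp y & pcat q r = Some p].
Proof.
pose T (z : pathalg K Q) := p \in msupp z ->
  exists q r, [/\ q \in msupp x, r \in msupp y & pcat q r = Some p].
have T0 : T 0 by rewrite /T msupp0.
have TD z t : T z -> T t -> T (z + t).
  by move=> Tz Tt /(fsubsetP (msuppD_le _ _)); rewrite inE => /orP[/Tz|/Tt].
have -> : x * y = pa_mul x y by [].
rewrite -/(T (pa_mul x y)) pa_mul.unlock big_seq.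
apply: (big_ind T) => // q qx; rewrite big_seq; apply: (big_ind T) => // r ry.
move=> /(fsubsetP (msuppZ_le _ _)); rewrite /pelt_mul.
case qr: (pcat q r) => [u|]; last by rewrite msupp0.
by rewrite msupp_pelt inE => /eqP ->; exists q, r.
Qed.

Definition supported (P : qpath Q -> Prop) x : Prop :=
  forall p, p \in msupp x -> P p.

(** These serve as test ideals: [ideal_gen] is the intersection of all ideals containing the
    generators, so applying it to [supported P] controls the support of every element of a generated
    ideal. *)
Lemma supported_ideal (P : qpath Q -> Prop) :
  (forall p q r, pcat p q = Some r -> P p \/ P q -> P r) -> ideal (supported P).
Proof.
move=> PM; split=> [p|x y Px Py p|x y Py p|x y Py p].
- by rewrite msupp0.
- by move=> /(fsubsetP (msuppD_le _ _)); rewrite inE => /orP[/Px|/Py].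
- by case/msupp_mul=> q [r [_ /Py ? /PM]]; apply; right.
- by case/msupp_mul=> q [r [/Py ? _ /PM]]; apply; left.
Qed.

Lemma supported_pelt (P : qpath Q -> Prop) p : supported P (pelt p) <-> P p.
Proof.
by rewrite /supported msupp_pelt; split=> [|Pp q]; [apply|]; rewrite inE // => /eqP ->.
Qed.

Lemma plen_pcat p q r : pcat p q = Some r -> plen r = (plen p + plen q)%N.
Proof. by rewrite /plen => /parrows_pcat ->; rewrite size_cat. Qed.

Lemma supported_plen_ideal n : ideal (supported (fun p => n <= plen p)%N).
Proof.
apply: supported_ideal => p q r /plen_pcat -> [] h; apply: leq_trans h _.
  exact: leq_addr.
exact: leq_addl.
Qed.

Lemma ideal_exp_pelt n p : (n <= plen p)%N ->
  ideal_exp (@arrow_ideal K Q) n (pelt p).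
Proof.
elim: n p => [//|n IH] p np; rewrite /plen in np.
case pE: (parrows p) np => [//|a s] np.
have [p1 [p2 [p1E p2E pp]]] := @pcat_split Q p [:: a] s pE.
move=> J _ JS; apply: JS; exists (pelt p1), (pelt p2); split.
- by move=> J' _; apply; exists a; rewrite (qpath_arrow p1E).
- by apply: IH; rewrite /plen p2E.
- by rewrite (pelt_pcat pp).
Qed.

Lemma ideal_exp2_supported x : ideal_exp (@arrow_ideal K Q) 2 x ->
  supported (fun p => 2 <= plen p)%N x.
Proof.
have arrow_len y : arrow_ideal y -> supported (fun p => 1 <= plen p)%N y.
  apply; first exact: supported_plen_ideal.
  by move=> _ [a ->]; apply/supported_pelt.
apply; first exact: supported_plen_ideal.
move=> _ [y [z [/arrow_len ylen zJ ->]]] p /msupp_mul[q [r [/ylen qlen rz]]].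
move=> /plen_pcat ->; apply: leq_add qlen _.
(* Since [ideal_exp] starts from the whole ring, [z] lies in the arrow ideal times that ring, so its
   support also has length at least 1. *)
apply: (zJ (supported (fun p => 1 <= plen p)%N)) rz; first exact: supported_plen_ideal.
by move=> _ [t [u [/arrow_len tlen _ ->]]]; case: (supported_plen_ideal 1) => _ _ _; apply.
Qed.

(** * Monomial ideals, maximal paths and the relation of lying on a common maximal path *)

Section BoundQuiver.
Variable I : pathalg K Q -> Prop.

Lemma apath_notin a : admissible I -> ~ I (pelt (apath a)).
Proof. by case=> _ [m [_ _ /[apply]]] /ideal_exp2_supported/supported_pelt. Qed.

(** The elements supported on paths of [I] form an ideal containing the generating paths, hence all
    of [I]. *)
Lemma monomial_supported x p :
  ideal I -> monomial I -> I x -> p \in msupp x -> I (pelt p).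
Proof.
move=> [_ _ Il Ir] [S IS] Ix; move: p; rewrite -/(supported (fun p => I (pelt p)) x).
move/IS: Ix; apply.
  by apply: supported_ideal => p q r /pelt_pcat <- []; [apply: Ir|apply: Il].
move=> _ [p Sp ->]; apply/supported_pelt/IS => J _; apply; by exists p.
Qed.

(** If [p] and [q] differ, [p] has coefficient 1 in the difference, so it is in the support. Thus a
    nonzero class is represented by a single path. *)
Lemma monomial_same_class p q : ideal I -> monomial I ->
  same_class I p q -> p = q \/ I (pelt p).
Proof.
move=> idI monI pq; case: (p =P q) => [|/eqP npq]; [by left | right].
apply: (monomial_supported idI monI pq); rewrite -mcoeff_neq0 mcoeffB pelt.unlock.
by rewrite !mcoeffU eqxx (eq_sym q) (negPf npq) subr0 oner_eq0.
Qed.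

Definition nonzero_prod a b : Prop := ~ I (pelt (apath a) * pelt (apath b)).

Lemma notin_pcat p q : ideal I -> ~ I (pelt p * pelt q) ->
  exists2 r, parrows r = parrows p ++ parrows q & ~ I (pelt r).
Proof.
case=> I0 _ _ _; rewrite peltM.
by case pq: (pcat p q) => [r|//] Ir; exists r; rewrite ?(parrows_pcat pq).
Qed.

Lemma nonzero_prod_tgt a b : ideal I -> nonzero_prod a b -> tgt a = src b.
Proof.
by case=> I0 _ _ _; rewrite /nonzero_prod peltM; case: pcatP => // r.
Qed.

Lemma nonzero_prod_infix p s1 a b s2 : ideal I -> ~ I (pelt p) ->
  parrows p = s1 ++ a :: b :: s2 -> nonzero_prod a b.
Proof.
move=> [_ _ Il Ir] Ip pE ab; apply: Ip.
have [p1 [p' [_ p'E /pelt_pcat<-]]] := pcat_split pE; apply: Il.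
have [pab [p2 [pabE _ /pelt_pcat<-]]] := @pcat_split Q p' [:: a; b] s2 p'E.
apply: Ir; have [pa [pb [/qpath_arrow-> /qpath_arrow-> /pelt_pcat<-]]] :=
  @pcat_split Q pab [:: a] [:: b] pabE.
exact: ab.
Qed.

Lemma nonzero_prod_walk p s1 a s2 b : ideal I -> ~ I (pelt p) ->
  parrows p = s1 ++ a :: s2 -> b \in a :: s2 ->
  clos_refl_trans _ nonzero_prod a b.
Proof.
move=> idI Ip; elim: s2 s1 a => [|c s2 IH] s1 a pE.
  by rewrite mem_seq1 => /eqP ->; apply: rt_refl.
rewrite inE => /predU1P[->|bc]; first exact: rt_refl.
apply: rt_trans (rt_step _ _ _ _ (nonzero_prod_infix idI Ip pE)) _.
by apply: (IH (rcons s1 a)) => //; rewrite cat_rcons.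
Qed.

(** A nonzero path that is not maximal extends by an arrow to a longer nonzero path; this stops
    because every path of length at least [n] is in [I]. *)
Lemma maximal_extension p : admissible I -> ~ I (pelt p) ->
  exists2 m, maximal_path I m & {subset parrows p <= parrows m}.
Proof.
case=> idI [n [_ In _]].
have len_lt q : ~ I (pelt q) -> (plen q < n)%N.
  by move=> Iq; rewrite ltnNge; apply/negP => /ideal_exp_pelt /In.
have [k] := ubnP (n - plen p); elim: k p => // k IH p npk Ip.
have [pmax|pnmax] := classic (maximal_path I p); first by exists p.
have [r [Ir rlen pr]] : exists r,
    [/\ ~ I (pelt r), (plen p < plen r)%N & {subset parrows p <= parrows r}].
  have [a] : exists a, ~ (I (pelt (apath a) * pelt p) /\ I (pelt p * pelt (apath a))).
    by apply: not_all_ex_not => pall; apply: pnmax.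
  case/not_and_or=> /(notin_pcat idI)[r rE Ir]; exists r; split=> //;
    rewrite /plen ?rE ?size_cat ?addn1 //.
    by move=> c pc; rewrite inE pc orbT.
  by move=> c pc; rewrite mem_cat pc.
have [|m mmax rm] := IH r _ Ir; last by exists m => // c /pr /rm.
by rewrite -ltnS (leq_trans _ npk) // ltnS ltn_sub2l // len_lt.
Qed.

Definition same_maximal a b : Prop :=
  exists2 m, maximal_path I m & a \in parrows m /\ b \in parrows m.

Lemma same_maximal_refl a : admissible I -> same_maximal a a.
Proof.
move=> admI; have [m mmax sub] := maximal_extension admI (@apath_notin a admI).
by exists m => //; split; apply: sub; rewrite inE.
Qed.

Lemma same_maximal_sym a b : same_maximal a b -> same_maximal b a.
Proof. by case=> m mmax [am bm]; exists m. Qed.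

Lemma same_maximal_prod a b : admissible I -> nonzero_prod a b -> same_maximal a b.
Proof.
move=> admI; case: (admI) => idI _ /(notin_pcat idI)[r rE Ir].
have [m mmax sub] := maximal_extension admI Ir.
by exists m => //; split; apply: sub; rewrite rE !inE eqxx ?orbT.
Qed.

(** Two maximal paths through [b] share the subpath [apath b], so UMP forces their classes to agree,
    and monomiality then makes the paths equal. *)
Lemma same_maximal_trans b a c : ideal I -> monomial I -> UMP I ->
  same_maximal a b -> same_maximal b c -> same_maximal a c.
Proof.
move=> idI monI umpI [m mmax [am bm]] [m' m'max [bm' cm']].
have same_refl w : same_class I w w by rewrite /same_class subrr; case: idI.
have [|mm'] := classic (same_class I m m').
  move=> /(monomial_same_class idI monI)[mm'|]; last by case: mmax.
  by subst m'; exists m.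
case: (umpI m m' mmax m'max mm' m m' _ _ (apath b)) => //; exact/subpath_apath.
Qed.

Lemma same_maximal_walk a b : ideal I -> same_maximal a b ->
  clos_refl_trans _ nonzero_prod a b \/ clos_refl_trans _ nonzero_prod b a.
Proof.
move=> idI [m [Im _] [am bm]]; case/splitPr mE: _ / am bm => [s1 s2].
rewrite mem_cat => /orP[bs1|]; last by left; apply: nonzero_prod_walk mE _.
right; case/splitPr: bs1 mE => [s3 s4]; rewrite -catA => mE.
by apply: nonzero_prod_walk mE _ => //; rewrite inE mem_cat inE eqxx !orbT.
Qed.

End BoundQuiver.
End Algebra.

(** * The paths [omega a] of a quiver that is not cyclic, as maximal linked sequences *)

Lemma path_last_unique (T : eqType) (e : rel T) (x : T) (s t : seq T) :
  (forall y z z', e y z -> e y z' -> z = z') ->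
  path e x s -> path e x t ->
  (forall d, ~~ e (last x s) d) -> (forall d, ~~ e (last x t) d) -> s = t.
Proof.
move=> ef; elim: s x t => [|y s IH] x [|z t] //=.
- by move=> _ /andP[xz _] /(_ z); rewrite xz.
- by move=> /andP[xy _] _ _ /(_ y); rewrite xy.
move=> /andP[xy ys] /andP[xz zt]; move: zt; rewrite -(ef _ _ _ xy xz) => yt hs ht.
by rewrite (IH y t).
Qed.

(** Turns the arrows before a given one into a walk starting at it, so that [path_last_unique] also
    applies on the left. *)
Lemma sorted_rcons_rev (T : Type) (e : rel T) (x : T) (s : seq T) :
  sorted e (rcons s x) = path (fun y z => e z y) x (rev s).
Proof. by rewrite -[in LHS](revK s) -rev_cons rev_sorted. Qed.

Section Linked.
Variable Q : quiver.
Implicit Types (w : qpath Q) (a b c d : arrow Q) (s : seq (arrow Q)).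

(* [linked a b]: the condition of Phi at the vertex between two consecutive
   arrows [a] and [b]. *)
Definition linked a b : bool :=
  [&& tgt a == src b, #|[pred c : arrow Q | src c == tgt a]| == 1%N
    & #|[pred c : arrow Q | tgt c == tgt a]| == 1%N].

Lemma linked_out a b c : linked a b -> src c = tgt a -> c = b.
Proof.
case/and3P=> /eqP ab /eqP/mem_card1[d dE] _ ca.
have := dE c; have := dE b; rewrite !inE -ab ca eqxx => /esym/eqP->.
by move/esym/eqP.
Qed.

Lemma linked_in a b c : linked a b -> tgt c = src b -> c = a.
Proof.
case/and3P=> /eqP ab _ /eqP/mem_card1[d dE] cb.
have := dE c; have := dE a; rewrite !inE cb -ab eqxx => /esym/eqP->.
by move/esym/eqP.
Qed.

Lemma linked_tgt a b : linked a b -> tgt a = src b.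
Proof. by case/and3P=> /eqP. Qed.

Lemma chain_path a s : chain (tgt a) s = path (fun b c => tgt b == src c) a s.
Proof. by elim: s a => //= b s IH a; rewrite IH eq_sym. Qed.

Lemma parrows_sorted w : sorted (fun b c => tgt b == src c) (parrows w).
Proof.
have := qpathP w; rewrite -/(parrows w); case: (parrows w) => //= a s.
by rewrite chain_path => /andP[].
Qed.

Lemma linked_qpath s : s != [::] -> sorted linked s -> exists w, parrows w = s.
Proof.
case: s => // a s _ als.
have as_chain : chain (src a) (a :: s).
  rewrite /= eqxx chain_path; apply: sub_path als => b c /linked_tgt/eqP //.
by exists (QPath (qpath_val := (src a, a :: s)) as_chain).
Qed.

Lemma Phi_linked a w : Phi a w <-> a \in parrows w /\ sorted linked (parrows w).
Proof.
rewrite /Phi subpath_apath; split=> -[aw wP]; split=> //.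
  apply/(sortedP a) => j jw; have [out_j in_j] := wP j jw.
  rewrite /linked out_j in_j !eqxx !andbT.
  by have /(sortedP a) := parrows_sorted w; apply.
move=> j jw /=; have /(sortedP a)/(_ j jw) := wP.
by case/and3P=> _ /eqP-> /eqP->.
Qed.

Variable omega : arrow Q -> qpath Q.
Hypothesis omega_max : forall a, Phi a (omega a) /\
  forall w, Phi a w -> (plen w <= plen (omega a))%N.

Lemma mem_omega a : a \in parrows (omega a).
Proof. by have [/Phi_linked[]] := omega_max a. Qed.

Lemma omega_sorted a : sorted linked (parrows (omega a)).
Proof. by have [/Phi_linked[]] := omega_max a. Qed.

Lemma omega_size a s : a \in s -> sorted linked s ->
  (size s <= size (parrows (omega a)))%N.
Proof.
move=> as_ ls; have [|w wE] := linked_qpath _ ls; first by case: (s) as_.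
rewrite -wE; apply: (proj2 (omega_max a)); apply/Phi_linked.
by rewrite wE.
Qed.

(** Adding [d] at either end would give a longer element of [Phi a]. Here [last c (rev s1)] is the
    first arrow of [omega a]. *)
Lemma omega_ends a c s1 s2 : parrows (omega a) = s1 ++ c :: s2 ->
  (forall d, ~~ linked (last c s2) d) /\ (forall d, ~~ linked d (last c (rev s1))).
Proof.
move=> wE; have := omega_sorted a; rewrite wE sorted_cat_cons => /andP[s1P s2P].
have := mem_omega a; rewrite wE => aw.
split=> d; apply/negP => ld.
  have := @omega_size a (s1 ++ c :: rcons s2 d).
  rewrite sorted_cat_cons s1P rcons_path s2P ld wE !size_cat /= size_rcons.
  rewrite -cats1 -cat_cons catA mem_cat aw => /(_ isT isT).
  by rewrite leq_add2l ltnn.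
have := @omega_size a (d :: s1 ++ c :: s2).
rewrite -cat_cons sorted_cat_cons s2P andbT sorted_rcons_rev rev_cons rcons_path.
rewrite -sorted_rcons_rev s1P ld.
by rewrite inE aw orbT wE ltnn => /(_ isT isT).
Qed.

(** Linked successors and predecessors are unique, and both paths are inextensible; read outwards
    from [c], their halves therefore coincide. *)
Lemma omega_mem a c : c \in parrows (omega a) -> omega c = omega a.
Proof.
move=> ca; apply: qpath_eq_parrows; first by case: (parrows _) (mem_omega c).
case/splitPr aE: _ / ca => [s1 s2]; case/splitPr cE: _ / (mem_omega c) => [t1 t2].
have [a2 a1] := omega_ends aE; have [c2 c1] := omega_ends cE.
have := omega_sorted a; rewrite aE sorted_cat_cons sorted_rcons_rev.
case/andP=> s1P s2P.
have := omega_sorted c; rewrite cE sorted_cat_cons sorted_rcons_rev.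
case/andP=> t1P t2P; congr (_ ++ _ :: _).
  apply/(can_inj revK)/(path_last_unique _ t1P s1P c1 a1).
  by move=> y z z' zy /linked_tgt zy'; rewrite (linked_in zy zy').
apply: (path_last_unique _ t2P s2P c2 a2).
by move=> y z z' yz /linked_tgt/esym yz'; rewrite (linked_out yz yz').
Qed.

(** If [a] and [b] are linked, [b] follows [a] in [omega a]. If not, anything following [a] in
    [omega a] would be linked to [a] and hence equal [b], so [a] is last; dually [b] is first in
    [omega b]. *)
Lemma omega_step a b : tgt a = src b -> omega a = omega b \/
  exists s s', parrows (omega a) = rcons s a /\ parrows (omega b) = b :: s'.
Proof.
move=> ab; case/splitPr aE: _ / (mem_omega a) => [s1 s2].
have := omega_sorted a; rewrite aE sorted_cat_cons => /andP[_ s2P].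
have [lab|lab] := boolP (linked a b).
  left; case: s2 aE s2P => [|d s2] aE /=.
    by have [/(_ b)] := omega_ends aE; rewrite lab.
  case/andP=> /linked_tgt/esym/(linked_out lab) dE _.
  by symmetry; apply: omega_mem; rewrite aE -dE mem_cat !inE eqxx !orbT.
right; case: s2 aE s2P => [|d s2] aE /=; last first.
  by case/andP=> ld; rewrite (linked_out ld (esym ab)) ld in lab *.
case/splitPr bE: _ / (mem_omega b) => [t1 t2].
have := omega_sorted b; rewrite bE sorted_cat_cons => /andP[+ _] _.
case/lastP: t1 bE => [|t1 d] bE; first by exists s1, t2; rewrite -cats1.
rewrite sorted_rcons_rev rev_rcons => /andP[ld _].
by rewrite (linked_in ld ab) ld in lab.
Qed.

End Linked.
Arguments linked {Q} a b.

(** * Reachability in the ramifications graph *)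

Lemma clos_rt_head_inv (T : Type) (R : T -> T -> Prop) x y :
  clos_refl_trans T R x y -> x = y \/ exists2 z, R x z & clos_refl_trans T R z y.
Proof.
move=> /clos_rt_rt1n_iff[|z t xz /clos_rt_rt1n_iff zt]; first by left.
by right; exists z.
Qed.

Lemma clos_rt_last_inv (T : Type) (R : T -> T -> Prop) x y :
  clos_refl_trans T R x y -> x = y \/ exists2 z, R z y & clos_refl_trans T R x z.
Proof.
move=> /clos_rt_rtn1_iff[|z t zt /clos_rt_rtn1_iff xz]; first by left.
by right; exists z.
Qed.

Lemma psrc_cons (Q : quiver) (w : qpath Q) a s : parrows w = a :: s -> psrc w = src a.
Proof.
move=> wE; have := qpathP w; rewrite -/(parrows w) wE /=.
by case/andP=> /eqP.
Qed.

Lemma ptgt_rcons (Q : quiver) (w : qpath Q) s a : parrows w = rcons s a -> ptgt w = tgt a.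
Proof. by rewrite /ptgt => ->; rewrite map_rcons last_rcons. Qed.

Section Reachability.
Variables (K : fieldType) (Q : quiver) (I : pathalg K Q -> Prop).
Variable omega : arrow Q -> qpath Q.
Hypothesis omega_max : forall a, Phi a (omega a) /\
  forall w, Phi a w -> (plen w <= plen (omega a))%N.
Hypotheses (admI : admissible I) (monI : monomial I) (umpI : UMP I).
Implicit Types (x y : qpath Q) (a b c d z : arrow Q) (s : seq (arrow Q)).

Local Notation reach := (clos_refl_trans (qpath Q) (ramif_arc I omega)).
Local Notation walk := (clos_refl_trans (arrow Q) (nonzero_prod I)).

Let idI : ideal I. Proof. by case: admI. Qed.

Lemma reach_step a b : nonzero_prod I a b -> reach (omega a) (omega b).
Proof.
move=> ab; have [->|/eqP nab] := eqVneq (omega a) (omega b); first exact: rt_refl.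
have tab := nonzero_prod_tgt idI ab.
have [//|[s [s' [aE bE]]]] := omega_step omega_max tab.
apply: rt_step; split=> //; [by exists a|by exists b| |].
  by rewrite (ptgt_rcons aE) (psrc_cons bE).
by exists s, s', a, b.
Qed.

Lemma reach_walk a b : walk a b -> reach (omega a) (omega b).
Proof.
elim=> [c d /reach_step //|c|c d e _ cd _ de]; first exact: rt_refl.
exact: rt_trans cd de.
Qed.

Lemma same_maximal_reach a b : same_maximal I a b ->
  reach (omega a) (omega b) \/ reach (omega b) (omega a).
Proof.
by case/(same_maximal_walk idI)=> /reach_walk; [left|right].
Qed.

(** By [omega_mem], the ends of an arc can be indexed by the two arrows at which they meet. *)
Lemma ramif_arcP x y : ramif_arc I omega x y -> exists b c,
  [/\ x = omega b, y = omega c, nonzero_prod I b c,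
      exists s, parrows x = rcons s b & exists s, parrows y = c :: s].
Proof.
case=> -[a ->] [d ->] _ _ [s [s' [b [c [bE cE bc]]]]]; exists b, c; split=> //.
- by rewrite (@omega_mem _ _ omega_max a b) // bE mem_rcons inE eqxx.
- by rewrite (@omega_mem _ _ omega_max d c) // cE inE eqxx.
- by exists s.
- by exists s'.
Qed.

(** A nonempty walk from [z] to [d] would end with the only arrow preceding [d], namely [c], whose
    product with [d] vanishes. *)
Lemma zero_linked_first c d z : linked c d -> ~ nonzero_prod I c d ->
  same_maximal I d z -> walk d z.
Proof.
move=> lcd ncd /(same_maximal_walk idI)[//|/clos_rt_rtn1_iff zd].
case: zd lcd ncd => [|e f ef _] lcd ncd; first exact: rt_refl.
by case: ncd; rewrite -(linked_in lcd (nonzero_prod_tgt idI ef)).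
Qed.

Lemma zero_linked_last c d z : linked c d -> ~ nonzero_prod I c d ->
  same_maximal I c z -> walk z c.
Proof.
move=> lcd ncd /(same_maximal_walk idI)[/clos_rt_rt1n_iff cz|//].
case: cz lcd ncd => [|e f ce _] lcd ncd; first exact: rt_refl.
by case: ncd; rewrite -(linked_out lcd (esym (nonzero_prod_tgt idI ce))).
Qed.

(** Induction from the right end. If the last product is zero, its second factor walks to everything
    on its maximal path. Otherwise the last two arrows share a maximal path and the claim for the
    shorter sequence transfers. *)
Lemma reach_from_last a c s : path linked c s ->
  {subset c :: s <= parrows (omega a)} ->
  same_maximal I c (last c s) \/
  forall z, same_maximal I (last c s) z -> reach (omega a) (omega z).
Proof.
elim/last_ind: s => [|s d IH] /=; first by left; apply: same_maximal_refl.
rewrite rcons_path last_rcons => /andP[cs lsd] sub.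
have [|cd] := classic (nonzero_prod I (last c s) d); last first.
  right=> z /(zero_linked_first lsd cd)/reach_walk.
  by rewrite (omega_mem omega_max (sub d _)) // inE mem_rcons inE eqxx orbT.
move/(same_maximal_prod admI)=> sd; case: (IH cs) => [e es|cl|cz].
- by apply: sub; rewrite -rcons_cons mem_rcons inE es orbT.
- by left; apply: same_maximal_trans cl sd.
- by right=> z dz; apply: cz; apply: same_maximal_trans sd dz.
Qed.

(** Dual of [reach_from_last], by induction from the left end. *)
Lemma reach_to_head a c s : path linked c s ->
  {subset c :: s <= parrows (omega a)} ->
  same_maximal I c (last c s) \/
  forall z, same_maximal I c z -> reach (omega z) (omega a).
Proof.
elim: s c => [|d s IH] c /=; first by left; apply: same_maximal_refl.
move=> /andP[lcd ds] sub.
have [|cd] := classic (nonzero_prod I c d); last first.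
  right=> z /(zero_linked_last lcd cd)/reach_walk.
  by rewrite (omega_mem omega_max (sub c _)) // inE eqxx.
move/(same_maximal_prod admI)=> cd; case: (IH d ds) => [e es|dl|dz].
- by apply: sub; rewrite inE es orbT.
- by left; apply: same_maximal_trans cd dl.
- right=> z cz; apply: dz.
  exact: same_maximal_trans (same_maximal_sym cd) cz.
Qed.

(* If the last arc of the path from [omega a] ends at a [y] whose two ends lie on
   the same maximal path, drop that arc and recurse; otherwise [y], and hence
   [omega a], reaches [omega z]. *)
Lemma reach_comparable_last a y s b z : reach (omega a) y ->
  parrows y = rcons s b -> same_maximal I b z ->
  reach (omega a) (omega z) \/ reach (omega z) (omega a).
Proof.
move=> /clos_rt_rtn1_iff ay; elim: ay s b z => [|y' y'' arc_y ay IH] s b z yE bz.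
  by rewrite -(omega_mem omega_max (c := b)) ?yE ?mem_rcons ?inE ?eqxx //;
    apply: same_maximal_reach.
have [d [c [_ y''E dc [s1 y'E] [s2 cE]]]] := ramif_arcP arc_y.
have bE : last c s2 = b by rewrite -[last c s2]/(last c (c :: s2)) -cE yE last_rcons.
have := omega_sorted omega_max c; rewrite -y''E cE => cs2.
have [|cl|yz] := reach_from_last (a := c) cs2.
- by rewrite -y''E cE.
(* The last arrow [d] of [y'] shares a maximal path with [c], then with [b], then with [z]. *)
- apply: IH y'E _; rewrite bE in cl.
  apply: (same_maximal_trans idI monI umpI (same_maximal_prod admI dc)).
  exact: same_maximal_trans cl bz.
left; apply: rt_trans (clos_rtn1_rt _ _ _ _ ay) _.
apply: rt_trans (rt_step _ _ _ _ arc_y) _.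
by rewrite y''E; apply: yz; rewrite bE.
Qed.

(** Dual of [reach_comparable_last]: the first arc is dropped, or [omega z] reaches [y]. *)
Lemma reach_comparable_head a y s b z : reach y (omega a) ->
  parrows y = b :: s -> same_maximal I b z ->
  reach (omega z) (omega a) \/ reach (omega a) (omega z).
Proof.
move=> /clos_rt_rt1n_iff; move aE: (omega a) => x ya.
elim: ya aE s b z => [{}x|{x}y' y'' x arc_y ya IH] aE s b z yE bz.
  rewrite -aE -(omega_mem omega_max (a := a) (c := b)) ?aE ?yE ?inE ?eqxx //.
  by case: (same_maximal_reach bz); [right|left].
have [d [c [y'E _ dc [s1 dE] [s2 y''E]]]] := ramif_arcP arc_y.
have bE : last b s = d by rewrite -[last b s]/(last b (b :: s)) -yE dE last_rcons.
have := omega_sorted omega_max d; rewrite -y'E yE => bs.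
have [|bl|yz] := reach_to_head (a := d) bs.
- by rewrite -y'E yE.
- apply: IH aE _ _ _ y''E _; rewrite bE in bl.
  apply: same_maximal_trans bz => //; apply: same_maximal_sym.
  exact: same_maximal_trans bl (same_maximal_prod admI dc).
left; apply: rt_trans (clos_rt1n_rt _ _ _ _ ya).
apply: rt_trans (rt_step _ _ _ _ arc_y).
by rewrite y'E; apply: yz.
Qed.

Lemma reach_comparable a y :
  clos_refl_trans _ (undirected_arc (ramif_graph I omega)) (omega a) y ->
  reach (omega a) y \/ reach y (omega a).
Proof.
move=> /clos_rt_rtn1_iff; elim=> [|y' y'' arc_y _ IH]; first by left; apply: rt_refl.
case: arc_y => /= arc_y; case: IH => ay.
- by left; apply: rt_trans ay _; apply: rt_step.
(* Branching at [y']: the first arrows [f] of [e] and [c] of [y''] both follow the last arrow [b] of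
   [y'], so they share its maximal path. *)
- case: (clos_rt_head_inv ay) => [<-|[e arc_e ea]]; first by left; apply: rt_step.
  have [b [c [_ -> bc [s1 y'E] _]]] := ramif_arcP arc_y.
  have [d [f [_ _ df [s2 y'E'] [s3 eE]]]] := ramif_arcP arc_e.
  move: y'E' df; rewrite y'E => /rcons_inj[_ <-] bf.
  have fc : same_maximal I f c.
    apply: (same_maximal_trans idI monI umpI (b := b)).
      exact/same_maximal_sym/same_maximal_prod.
    exact: same_maximal_prod.
  by case: (reach_comparable_head ea eE fc); [right|left].
(* Merging at [y']: the last arrows [d] of [e] and [b] of [y''] both precede the first arrow [c] of
   [y']. *)
- case: (clos_rt_last_inv ay) => [->|[e arc_e ae]]; first by right; apply: rt_step.
  have [b [c [-> _ bc _ [s1 y'E]]]] := ramif_arcP arc_y.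
  have [d [f [_ _ df [s2 eE] [s3 y'E']]]] := ramif_arcP arc_e.
  move: y'E' df; rewrite y'E => -[<- _] dc.
  apply: (reach_comparable_last ae eE).
  apply: (same_maximal_trans idI monI umpI (b := c)).
    exact: same_maximal_prod.
  exact/same_maximal_sym/same_maximal_prod.
- by right; apply: rt_trans ay; apply: rt_step.
Qed.

End Reachability.

Theorem theorem2p1 (K : closedFieldType) (Q : quiver)
    (I : pathalg K Q -> Prop) (omega : arrow Q -> qpath Q) :
  connected_quiver Q ->
  admissible I ->
  monomial I ->
  ramification_family omega ->
  UMP I ->
  forall H : digraph (qpath Q),
    weak_component (ramif_graph I omega) H -> unilaterally_connected H.
Proof.
move=> _ admI monI [omega_cyclic omega_max] umpI H [[x [a xa] HE] arcE].
(* An oriented path starting in [H] stays in [H], since [H] is closed under undirected arcs and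
   carries every arc between its vertices. *)
have Harc y z : vtx H y -> clos_refl_trans _ (ramif_arc I omega) y z ->
    clos_refl_trans _ (Defs.arc H) y z.
  move=> + /clos_rt_rt1n_iff yz; elim: yz => [t _|t u v tu _ IH Ht]; first exact: rt_refl.
  have Hu : vtx H u.
    by apply/HE/(rt_trans _ _ _ _ _ (proj1 (HE t) Ht)); apply: rt_step; left.
  by apply: rt_trans (IH Hu); apply/rt_step/arcE.
have Hramif y : vtx H y -> ramif_vtx omega y.
  by move/HE/clos_rt_rtn1_iff; case=> [|t u [] []//]; exists a.
move=> i j Hi Hj.
have [Qcyc|Qncyc] := classic (cyclic_quiver Q).
  (* For a cyclic quiver the graph has at most one vertex. *)
  have [w [_ _ wE]] := omega_cyclic Qcyc.
  have [b ->] := Hramif i Hi; have [c ->] := Hramif j Hj.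
  by rewrite !wE; left; apply: rt_refl.
have ij : clos_refl_trans _ (undirected_arc (ramif_graph I omega)) i j.
  apply: (rt_trans _ _ _ x); last exact/HE.
  move/HE: Hi; elim=> [y z yz|y|y z t _ yz _ zt]; [|exact: rt_refl|exact: rt_trans zt yz].
  by apply: rt_step; case: yz; [right|left].
have [b iE] := Hramif i Hi; rewrite iE in ij.
have [] := reach_comparable (omega_max Qncyc) admI monI umpI ij; rewrite -iE.
  by left; apply: Harc.
by right; apply: Harc.
Qed.
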